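(* Let $G$ and $H$ be graphs with $\chi_f(H)\le\chi_f(G)$, and let $n$ be a positive integer. Put $$\tau(G,n)=\frac{1}{\sum_{k=0}^{n-1}(\chi_f(G)-1)^k},\qquad \tau'(G,n,H)=\frac{1}{\chi_f(H)\left(\sum_{k=0}^{n-1}(\chi_f(G)-1)^k\right)+1-\chi_f(H)}.$$ Then $$\chi_f(\Delta_{H,n}(G))=\begin{cases}\chi_f(G)+\tau(G,n) & \text{if } n \text{ is even},\\ \chi_f(G)+\chi_f(H)\,\tau'(G,n,H) & \text{if } n\text{ is odd}.\end{cases}$$
   Context: Graphs are finite and simple, with nonempty vertex set. The convention $0^0=1$ is used in the sums. $\chi_f$ denotes the fractional chromatic number: $\chi_f(G)$ is the minimum of $\sum_{I}f(I)$ over all maps $f$ from the family of independent sets of $G$ to $[0,1]$ such that $\sum_{I\ni v}f(I)\ge 1$ for every vertex $v$ of $G$. For a positive integer $n$, the $n$th cone $\Delta_n(G)$ over $G$ is the graph with vertex set $(V(G)\times\{0,1,\ldots,n-1\})\cup\{\star\}$ and edge set $\{(x,i)(y,j): xy\in E(G),\ |i-j|=1 \text{ or } i=j=0\}\cup\{(x,n-1)\star: x\in V(G)\}$. For a map $h:V(H)\to\mathbb{N}$ (positive integers), the $(H,h)$-cone $\Delta_{H,h}(G)$ over $G$ is defined as follows. For each $v\in V(H)$ take a copy $\Delta_{h(v)}(G,v)$ of $\Delta_{h(v)}(G)$ with vertex set $\{(u,v):u\in V(\Delta_{h(v)}(G))\}$. Take the disjoint union of these copies over $v\in V(H)$, identify,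 for each $x\in V(G)$, all vertices $((x,0),v)$, $v\in V(H)$, into a single vertex $(x,0)$, and add the edges $(\star,v)(\star,v')$ for all $vv'\in E(H)$. If $h(v)=n$ for all $v\in V(H)$, the graph is denoted $\Delta_{H,n}(G)$. *)

(* Defs.v *)
From HB Require Import structures.
From mathcomp Require Import all_boot all_order all_algebra.
From mathcomp Require Import all_classical all_reals topology normedtype derive.

Set Implicit Arguments.
Unset Strict Implicit.
Unset Printing Implicit Defensive.

Import Order.TTheory GRing.Theory Num.Theory.
Import numFieldNormedType.Exports.

Local Open Scope classical_set_scope.
Local Open Scope quotient_scope.
Local Open Scope ring_scope.

Record sgraph := SGraph {
  vertex :> finType;
  adj : rel vertex;
  adj_sym : symmetric adj;
  adj_irr : irreflexive adj;
  vertex_gt0 : (0 < #|vertex|)%N }.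

Definition independent (G : sgraph) (I : {set G}) : bool :=
  [forall x in I, forall y in I, ~~ adj x y].

Section FractionalChromaticNumber.
Variables (R : realType) (G : sgraph).

(* The values of f on sets that are not independent play no role. *)
Definition fractional_coloring : set ({set G} -> R) :=
  [set f | (forall I, independent I -> 0 <= f I <= 1) /\
           (forall v : G, 1 <= \sum_(I | independent I && (v \in I)) f I)].

Definition weight (f : {set G} -> R) : R := \sum_(I | independent I) f I.

(* This infimum is a minimum: see [chi_f_attained] and [chi_f_le]. *)
Definition chi_f : R := inf [set weight f | f in fractional_coloring].

Lemma weight_ge0 f : fractional_coloring f -> 0 <= weight f.
Proof. by move=> [f01 _]; apply: sumr_ge0 => I /f01 /andP[]. Qed.

Lemma chi_f_le f : fractional_coloring f -> chi_f <= weight f.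
Proof.
move=> fc; apply: ge_inf; last by exists f.
by exists 0 => _ [g /weight_ge0 g0 <-].
Qed.

Let X := prod_topology (fun _ : {set G} => R : topologicalType).

Lemma eval_sum_continuous (P : pred {set G}) :
  continuous (fun f : X => \sum_(I | P I) f I : R).
Proof.
have evC I : continuous (fun f : X => f I : R).
  exact: (@proj_continuous {set G} (fun _ => R : topologicalType) I).
elim: (index_enum _) => [|I r IHr].
  rewrite (_ : (fun _ => _) = cst 0); first exact: cst_continuous.
  by apply/funext => f; rewrite big_nil.
rewrite (_ : (fun f : X => \sum_(J <- I :: r | P J) f J) =
    fun f : X => if P I then f I + \sum_(J <- r | P J) f J
                 else \sum_(J <- r | P J) f J); last first.
  by apply/funext => f; rewrite big_cons.
case: (P I) => // f.
exact: (@cvgD R R X (nbhs f) _ (fun g : X => g I)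
  (fun g : X => \sum_(J <- r | P J) g J) _ _ (evC I f) (IHr f)).
Qed.

Lemma chi_f_attained : exists2 f, fractional_coloring f & weight f = chi_f.
Proof.
pose K := [set f : X | forall I, `[0, 1]%classic (f I)].
pose C := [set f : X | forall v : G,
  1 <= \sum_(I | independent I && (v \in I)) f I].
have cK : compact K.
  exact: (@tychonoff {set G} (fun _ => R : topologicalType)
    (fun _ => `[0, 1]%classic) (fun _ => @segment_compact R 0 1)).
have cC : closed C.
  have -> : C = \bigcap_(v in [set: G])
      ((fun f : X => \sum_(I | independent I && (v \in I)) f I : R) @^-1`
         [set x | 1 <= x]).
    by apply/seteqP; split => [f Cf v _ | f Cf v]; [exact: Cf | exact: Cf].
  apply: closed_bigI => v _; apply: preimage_closed; last exact: closed_ge.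
  by move=> f _; exact: eval_sum_continuous.
have cKC : compact (K `&` C) by apply: compact_closedI.
have KCfc f : (K `&` C) f -> fractional_coloring f.
  by move=> [Kf Cf]; split => // I _; have := Kf I; rewrite /= in_itv.
have KC0 : K `&` C !=set0.
  exists (fun=> 1); split=> [I|v] /=; first by rewrite in_itv /= ler01 lexx.
  rewrite (bigD1 [set v]%SET) /=; last first.
    rewrite inE eqxx andbT; apply/forall_inP => x /set1P ->.
    by apply/forall_inP => y /set1P ->; rewrite adj_irr.
  by rewrite lerDl sumr_ge0.
have [f /[!inE] KCf fmin] : exists2 c : X, c \in (K `&` C) &
    forall t, t \in (K `&` C) -> weight c <= weight t.
  apply: (@compact_EVT_min X R weight _ KC0 cKC).
  by apply: continuous_subspaceT; exact: eval_sum_continuous.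
exists f; first exact: KCfc.
apply/eqP; rewrite eq_le chi_f_le ?andbT; last exact: KCfc.
apply: lb_le_inf; first by exists (weight f), f => //; exact: KCfc.
move=> _ [g [g01 gcov] <-].
pose g' : X := fun I => if independent I then g I else 0.
have -> : weight g = weight g'.
  by apply: eq_bigr => I indI; rewrite /g' indI.
apply: fmin; rewrite inE; split=> [I|v] /=.
  rewrite in_itv /= /g'; case: ifP => [/g01 //|_].
  by rewrite lexx ler01.
by rewrite (le_trans (gcov v))// le_eqVlt; apply/orP; left; apply/eqP;
  apply: eq_bigr => I /andP[indI _]; rewrite /g' indI.
Qed.

End FractionalChromaticNumber.

Section Cone.
Variables (G : sgraph) (n : nat).

(* [None] is the apex. Only n > 0 is meaningful. *)
Definition cone_vertex := option (G * 'I_n).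

Definition cone_adj : rel cone_vertex := fun p q =>
  match p, q with
  | Some (x, i), Some (y, j) =>
      adj x y &&
      [|| i.+1 == j, j.+1 == i | (i == 0%N :> nat) && (j == 0%N :> nat)]
  | Some (_, i), None | None, Some (_, i) => i.+1 == n
  | None, None => false
  end.

Lemma cone_adj_sym : symmetric cone_adj.
Proof.
move=> [[x i]|] [[y j]|] //=; rewrite adj_sym; congr andb.
by rewrite orbCA [X in [|| _, _ | X]]andbC.
Qed.

Lemma cone_adj_irr : irreflexive cone_adj.
Proof. by move=> [[x i]|] //=; rewrite adj_irr. Qed.

Lemma cone_vertex_gt0 : (0 < #|{: cone_vertex}|)%N.
Proof. by apply/card_gt0P; exists None. Qed.

Definition cone : sgraph := SGraph cone_adj_sym cone_adj_irr cone_vertex_gt0.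

End Cone.

Section GeneralizedCone.
Variables (H : sgraph) (h : H -> nat) (G : sgraph).

Definition cone_copies : finType := {v : H & cone G (h v)}.

(* The underlying vertex of G at level 0; copies of it are glued by [ident]. *)
Definition base (p : cone_copies) : option G :=
  if tagged p is Some (x, i) then if i == 0%N :> nat then Some x else None
  else None.

Definition ident : rel cone_copies :=
  fun p q => (p == q) || (base p != None) && (base p == base q).

Lemma ident_equiv : equiv_class_of ident.
Proof.
split=> [p|p q|q p r]; first by rewrite /ident eqxx.
  rewrite /ident [q == p]eq_sym [base q == base p]eq_sym; congr orb.
  by case: (base p =P base q) => [->|_] //; rewrite !andbF.
rewrite /ident => /orP[/eqP->//|/andP[p0 /eqP pq]].
case/orP=> [/eqP<-|/andP[q0 /eqP<-]]; by rewrite p0 pq eqxx orbT.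
Qed.

Canonical ident_equivRel := EquivRelPack ident_equiv.

Definition hcone_vertex := {eq_quot ident}.
HB.instance Definition _ := EqQuotient.on hcone_vertex.
HB.instance Definition _ := Countable.on hcone_vertex.
HB.instance Definition _ :=
  isFinite.Build hcone_vertex (pcan_enumP (can_pcan (@reprK _ hcone_vertex))).

(* Adjacency before identification: inside one copy, or between the apexes of
   the copies attached to adjacent vertices of H. *)
Definition copies_adj : rel cone_copies := fun p q =>
  (tag p == tag q) && adj (tagged p) (tagged_as p q)
  || [&& tagged p == None, tagged q == None & adj (tag p) (tag q)].

Lemma copies_adj_sym : symmetric copies_adj.
Proof.
suff half p q : copies_adj p q -> copies_adj q p
  by move=> p q; apply/idP/idP; apply: half.
case: p q => [v s] [w t] /orP[|/and3P[/= s0 t0 vw]]; last first.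
  by apply/orP; right; rewrite /= s0 t0 adj_sym.
case/andP=> /= /eqP vw; case: _ / vw t => t.
rewrite tagged_asE => st; apply/orP; left.
by rewrite eqxx tagged_asE /= cone_adj_sym.
Qed.

Lemma copies_adj_base p q :
  base p != None -> base p = base q -> ~~ copies_adj p q.
Proof.
case: p q => [v s] [w t] p0 pq; apply/negP => /orP[|/and3P[/= /eqP s0]]; last first.
  by move: p0; rewrite s0.
case/andP=> /= /eqP vw; case: _ / vw t pq => t pq; rewrite tagged_asE.
move: s t p0 pq => [[x i]|] [[y j]|] //=; rewrite /base /=.
  by do 2!case: ifP => // _; move=> _ [->]; rewrite adj_irr.
by case: ifP.
Qed.

Lemma copies_adj_irr : irreflexive copies_adj.
Proof. by move=> [v s]; rewrite /copies_adj tagged_asE !adj_irr !andbF. Qed.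

Definition hcone_adj : rel hcone_vertex := fun a b =>
  [exists p : cone_copies, exists q : cone_copies,
     [&& \pi_hcone_vertex p == a, \pi_hcone_vertex q == b & copies_adj p q]].

Lemma hcone_adj_sym : symmetric hcone_adj.
Proof.
suff half a b : hcone_adj a b -> hcone_adj b a
  by move=> a b; apply/idP/idP; apply: half.
case/existsP=> p /existsP[q /and3P[pa qb pq]].
by apply/existsP; exists q; apply/existsP; exists p; rewrite pa qb copies_adj_sym.
Qed.

Lemma hcone_adj_irr : irreflexive hcone_adj.
Proof.
move=> a; apply/negbTE/negP; case/existsP=> p /existsP[q /and3P[/eqP pa /eqP qa pq]].
have /eqmodP : p = q %[mod hcone_vertex] by rewrite pa qa.
rewrite /= /ident => /orP[/eqP pq0|/andP[p0 /eqP bpq]].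
  by move: pq; rewrite pq0 copies_adj_irr.
by move: pq; apply/negP; exact: copies_adj_base.
Qed.

Lemma hcone_vertex_gt0 : (0 < #|{: hcone_vertex}|)%N.
Proof.
have /card_gt0P[v _] := vertex_gt0 H.
by apply/card_gt0P; exists (\pi_hcone_vertex (existT (fun v => cone G (h v)) v None)).
Qed.

Definition hcone : sgraph := SGraph hcone_adj_sym hcone_adj_irr hcone_vertex_gt0.

End GeneralizedCone.

Section Tau.
Variables (R : realType) (G H : sgraph) (n : nat).

Definition tau : R := (\sum_(0 <= k < n) (chi_f R G - 1) ^+ k)^-1.

Definition tau' : R :=
  (chi_f R H * (\sum_(0 <= k < n) (chi_f R G - 1) ^+ k) + 1 - chi_f R H)^-1.

End Tau.

(* Main.v *)
(* Write a, b for the fractional chromatic numbers of G, H and q = a - 1, and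
   suppose a >= 2; otherwise G and H are edgeless and the cone is bipartite.

   Lower bound: weigh the level i > 0 of the copy v by q^(n-1-i) u(v) w(x) and
   its apex by u(v), where w and u are optimal fractional cliques of G and H (for
   n even, u is concentrated on a single vertex). An independent set of a cone is
   a chain of level sets A_i without edges between A_i and A_(i+1). Each
   A_i splits into the core S_i = A_i /\ (A_(i-1) \/ A_(i+1)) and a rest T_i.
   The set S_i \/ S_(i+1) is independent and has neither neighbours nor members
   in T_i \/ T_(i+1), so w(T_i) + w(T_(i+1)) <= a (1 - w(S_i \/ S_(i+1))). A
   combination of these inequalities bounds the weight of the chain.

   Upper bound: given an independent set I of G, take I on the levels below j and
   then alternate between the empty set and all of G, adding the apex if the last
   level is empty. With j drawn at rate theta q^(j-1), and the copies that use
   their apex drawn from an optimal fractional colouring of H, every vertex is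
   covered exactly; chi_f H <= chi_f G makes room for the apexes. *)
Require Import Defs.
From mathcomp Require Import all_boot all_order all_algebra.
From mathcomp Require Import all_classical all_reals.
From mathcomp Require Import ring lra zify.

Set Implicit Arguments.
Unset Strict Implicit.
Unset Printing Implicit Defensive.

Import Order.TTheory GRing.Theory Num.Theory.
Local Open Scope ring_scope.

(** * Independent sets and a theorem of the alternative *)

Lemma independentP (G : sgraph) (I : {set G}) :
  reflect {in I &, forall x y, ~~ adj x y} (independent I).
Proof.
apply: (iffP forall_inP) => [indI x y xI yI|indI x xI].
  exact: (forall_inP (indI x xI)).
by apply/forall_inP => y; exact: indI.
Qed.

Lemma independentS (G : sgraph) (I J : {set G}) :
  I \subset J -> independent J -> independent I.
Proof.
move=> /fintype.subsetP IJ /independentP indJ.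
by apply/independentP => x y /IJ xJ /IJ; exact: indJ.
Qed.

Lemma independent0 (G : sgraph) : independent (finset.set0 : {set G}).
Proof. by apply/independentP => x y; rewrite inE. Qed.

(** Farkas' lemma, by induction on the number of constraints; with none left, testing [x = c] forces
    [c = 0]. It supplies the duality behind [fractional_clique]. *)
Lemma farkas (R : realFieldType) (J T : finType) (r : seq J)
    (A : J -> T -> R) (c : T -> R) :
  uniq r ->
  (forall x : T -> R, (forall j, j \in r -> \sum_t A j t * x t <= 0) ->
    \sum_t c t * x t <= 0) ->
  exists2 u : J -> R, (forall j, 0 <= u j) &
    forall t, c t = \sum_(j <- r) u j * A j t.
Proof.
elim: r A c => [|j r IHr] A c /=.
  move=> _ cone_c; exists (fun=> 0) => // t; rewrite big_nil.
  have c2 : \sum_t c t * c t <= 0 by exact: cone_c.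
  have c2_ge0 i : true -> 0 <= c i * c i by rewrite -expr2 sqr_ge0.
  have /eqP c20 : \sum_t c t * c t == 0 by rewrite eq_le c2 sumr_ge0.
  by apply/eqP; rewrite -sqrf_eq0 expr2 (psumr_eq0P c2_ge0 c20).
move=> /andP[jr uniq_r] cone_c.
(* If the constraint j cannot be dropped, some x0 violates only that one; project
   along x0 onto the kernel of A j. *)
have [cone_r|] := pselect (forall x : T -> R,
    (forall i, i \in r -> \sum_t A i t * x t <= 0) -> \sum_t c t * x t <= 0).
  have [u u0 uE] := IHr A c uniq_r cone_r.
  exists (fun i => if i == j then 0 else u i) => [i|t]; first by case: ifP.
  rewrite big_cons eqxx mul0r add0r uE; apply: eq_big_seq => i ir.
  by case: eqP => // ij; rewrite -ij ir in jr.
move=> /existsNP[x0 /not_implyP[Ax0 /negP]]; rewrite -ltNge => cx0.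
pose a i := \sum_t A i t * x0 t; pose b := \sum_t c t * x0 t.
have aj : 0 < a j.
  rewrite ltNge; apply/negP => aj; move: cx0; rewrite ltNge => /negP; apply.
  by apply: cone_c => i; rewrite inE => /predU1P[->//|]; exact: Ax0.
pose A' i t := A i t - a i / a j * A j t; pose c' t := c t - b / a j * A j t.
have [u u0 uE] : exists2 u : J -> R, (forall i, 0 <= u i) &
    forall t, c' t = \sum_(i <- r) u i * A' i t.
  apply: IHr => // x A'x.
  (* This [k] makes [x - k * x0] vanish under [A j]; [dotE] moves the correction from the vector to
     the functional. *)
  pose k := (\sum_t A j t * x t) / a j.
  have dotE (d : T -> R) : \sum_t d t * (x t - k * x0 t) =
      \sum_t (d t - (\sum_t d t * x0 t) / a j * A j t) * x t.
    transitivity (\sum_t d t * x t - k * \sum_t d t * x0 t).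
      by rewrite mulr_sumr -sumrB; apply: eq_bigr => t _; ring.
    have -> : k * (\sum_t d t * x0 t) =
        (\sum_t d t * x0 t) / a j * \sum_t A j t * x t by rewrite /k; ring.
    by rewrite mulr_sumr -sumrB; apply: eq_bigr => t _; ring.
  rewrite -dotE; apply: cone_c => i; rewrite inE => /predU1P[->|ir].
    rewrite dotE big1 // => t _; rewrite -/(a j) divff ?gt_eqF//; ring.
  by rewrite dotE; exact: A'x.
(* The coefficient of [A j] left after expanding [c'] and [A']. It is nonnegative since [b] and
   [a j] are positive and [a i <= 0] on [r]. *)
pose uj := b / a j - \sum_(i <- r) u i * (a i / a j).
exists (fun i => if i == j then uj else u i) => [i|t].
  case: ifP => // _; rewrite subr_ge0; apply: (@le_trans _ _ 0).
    rewrite big_seq; apply: sumr_le0 => i0 i0r.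
    by rewrite mulr_ge0_le0// mulr_le0_ge0 ?invr_ge0 ?(ltW aj)//; exact: Ax0.
  by rewrite divr_ge0 ?ltW.
have cE : c t = c' t + b / a j * A j t by rewrite /c'; ring.
rewrite cE uE big_cons eqxx /uj mulrBl.
have -> : \sum_(i <- r) u i * A' i t = \sum_(i <- r)
    (if i == j then uj else u i) * A i t - (\sum_(i <- r) u i * (a i / a j)) * A j t.
  rewrite mulr_suml -sumrB; apply: eq_big_seq => i ir.
  by case: eqP => [ij|_]; [rewrite -ij ir in jr|rewrite /A'; ring].
by rewrite /uj; ring.
Qed.

(** * Linear programming duality and exact covers *)

Section FractionalChromaticNumberTheory.
Variables (R : realType) (G : sgraph).
Local Notation a := (chi_f R G).

(** Repeated sets are merged and their mass is truncated at 1: a set that reaches 1 covers its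
    vertices alone, and a vertex in no such set loses nothing. *)
Lemma chi_f_le_cover (O : finType) (mu : O -> R) (S : O -> {set G}) :
  (forall o, 0 <= mu o) -> (forall o, independent (S o)) ->
  (forall v, 1 <= \sum_(o | v \in S o) mu o) -> a <= \sum_o mu o.
Proof.
move=> mu0 indS cov.
pose F I := \sum_(o | S o == I) mu o; pose f I := Num.min 1 (F I).
have F0 I : 0 <= F I by apply: sumr_ge0.
have f0 I : 0 <= f I by rewrite le_min ler01 F0.
have fc : fractional_coloring f.
  split=> [I _|v]; first by rewrite f0 ge_min lexx.
  have [/existsP[I /andP[/andP[indI vI] FI]]|] :=
    boolP [exists I, independent I && (v \in I) && (1 <= F I)].
    rewrite (bigD1 I) ?indI//= (_ : f I = 1); last exact/min_idPl.
    by rewrite lerDl sumr_ge0.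
  move=> /existsPn smallF; apply: (le_trans (cov v)).
  rewrite (partition_big S (fun I => independent I && (v \in I))) /=; last first.
    by move=> o vo; rewrite indS.
  apply: ler_sum => I indI; rewrite [f I](_ : _ = F I).
    rewrite le_eqVlt; apply/orP; left; apply/eqP.
    apply: eq_bigl => o; case: eqP => [->|]; rewrite ?andbF// andbT.
    by case/andP: indI.
  by apply/min_idPr; have := smallF I; rewrite indI /= -ltNge => /ltW.
apply: (le_trans (chi_f_le fc)); rewrite (partition_big S predT) //= /weight.
rewrite [leRHS](bigID (@independent G)) /= -[leLHS]addr0 lerD //.
  by apply: ler_sum => I _; rewrite ge_min lexx orbT.
by apply: sumr_ge0 => I _; apply: sumr_ge0.
Qed.

(** Weak duality, by double counting against an optimal colouring. Repetitions in [p] let the weight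
    of one vertex be spread over several indices. *)
Lemma chi_f_ge_packing (O : finType) (w : O -> R) (p : O -> G) :
  (forall o, 0 <= w o) ->
  (forall I, independent I -> \sum_(o | p o \in I) w o <= 1) ->
  \sum_o w o <= a.
Proof.
move=> w0 wI; have [f [f01 fcov] <-] := chi_f_attained R G.
apply: (@le_trans _ _ (\sum_o w o * \sum_(I | independent I && (p o \in I)) f I)).
  by apply: ler_sum => o _; rewrite ler_peMr.
under eq_bigr do rewrite mulr_sumr.
rewrite (exchange_big_dep (@independent G)) /=; last by move=> o I _ /andP[].
apply: ler_sum => I indI; under eq_bigl do rewrite indI.
by rewrite -mulr_suml ler_piMl ?wI//; case/andP: (f01 I indI).
Qed.

Lemma chi_f_ge1 : 1 <= a.
Proof.
have /card_gt0P[v _] := vertex_gt0 G.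
have := @chi_f_ge_packing unit (fun=> 1) (fun=> v).
rewrite big_const card_unit /= addr0; apply=> // I indI.
by rewrite big_mkcond big_const card_unit /= addr0; case: ifP.
Qed.

Lemma chi_f_edge_ge2 (x y : G) : adj x y -> 2 <= a.
Proof.
move=> xy; have := @chi_f_ge_packing bool (fun=> 1) (fun b => if b then x else y).
rewrite big_bool; apply=> // I /independentP indI.
rewrite big_mkcond big_bool /=; case: ifP => xI; case: ifP => yI; rewrite ?addr0 ?add0r//.
by have := indI _ _ xI yI; rewrite xy.
Qed.

Lemma chi_f_edgeless : (forall x y : G, ~~ adj x y) -> a = 1.
Proof.
move=> noadj; apply/eqP; rewrite eq_le chi_f_ge1 andbT.
have := @chi_f_le_cover unit (fun=> 1) (fun=> [set: G]%SET).
rewrite big_const card_unit /= addr0; apply=> // [_|v].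
  by apply/independentP => x y _ _; exact: noadj.
by rewrite big_mkcond big_const card_unit /= addr0 inE.
Qed.

Lemma chi_f_lt2 : a < 2 -> forall x y : G, ~~ adj x y.
Proof. by move=> a2 x y; apply: contraL a2 => /chi_f_edge_ge2; rewrite leNgt. Qed.

Lemma sum_independent (P : pred {set G}) (F : {set G} -> R) :
  \sum_(I : {J in @independent G} | P (val I)) F (val I) =
  \sum_(I | independent I && P I) F I.
Proof. by rewrite -big_sub_cond; apply: eq_bigl => I; rewrite unfold_in. Qed.

(** Strong duality through [farkas]. The test vector has masses [x (Some I)] and a homogenizing
    entry [x None], the amount demanded at each vertex; the multipliers of the covering constraints
    [inl v] form the clique. *)
Lemma fractional_clique : exists w : G -> R,
  [/\ forall v, 0 <= w v, \sum_v w v = a &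
      forall I : {set G}, independent I -> \sum_(v in I) w v <= 1].
Proof.
pose A (j : G + {set G}) (t : option {set G}) : R :=
  match j, t with
  | inl v, Some J => - (independent J && (v \in J))%:R
  | inl v, None => 1
  | inr J, Some K => - (J == K)%:R
  | inr _, None => 0
  end.
pose c (t : option {set G}) : R :=
  if t is Some J then - (independent J)%:R else a.
have optE (F : option {set G} -> R) : \sum_t F t = F None + \sum_I F (Some I).
  rewrite (bigD1 None) //=; congr (_ + _).
  rewrite (reindex_omap Some id) /=; last by case.
  by apply: eq_bigl => I; rewrite eqxx.
have [u u0 uE] : exists2 u : G + {set G} -> R, (forall j, 0 <= u j) &
    forall t, c t = \sum_(j <- index_enum _) u j * A j t.
  apply: farkas; first exact: index_enum_uniq.
  move=> x Ax.
  have x0 I : 0 <= x (Some I).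
    have := Ax (inr I) (mem_index_enum _).
    rewrite optE /= mul0r add0r (bigD1 I) //= eqxx big1 ?addr0 ?mulN1r ?oppr_le0//.
    by move=> J /negbTE; rewrite eq_sym => ->; rewrite oppr0 mul0r.
  have xcov v : x None <= \sum_(I | independent I && (v \in I)) x (Some I).
    have := Ax (inl v) (mem_index_enum _).
    rewrite optE /= mul1r -lerBrDr sub0r => /le_trans; apply.
    rewrite -sumrN [leRHS]big_mkcond /=; apply: ler_sum => I _.
    by case: ifP => _; rewrite ?mulN1r ?opprK// oppr0 mul0r oppr0.
  rewrite optE /= -lerBrDr sub0r -sumrN.
  have -> : \sum_I - (- (independent I)%:R * x (Some I)) =
      \sum_(I | independent I) x (Some I).
    rewrite [RHS]big_mkcond; apply: eq_bigr => I _.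
    by case: ifP; rewrite ?mulN1r ?opprK// oppr0 mul0r oppr0.
  (* Dividing by a positive [x None] gives a genuine cover; otherwise the two sides are separated by
     0. *)
  have [z0|z0] := ltP 0 (x None); last first.
    apply: (@le_trans _ _ 0); last exact: sumr_ge0.
    by rewrite mulr_ge0_le0// (le_trans ler01 chi_f_ge1).
  rewrite -ler_pdivlMr//.
  have := @chi_f_le_cover {I in @independent G}
    (fun I => x (Some (val I)) / x None) val.
  rewrite -mulr_suml.
  rewrite (sum_independent predT (x \o Some)); under eq_bigl do rewrite andbT; apply.
  - by move=> I; rewrite divr_ge0// ltW.
  - exact: valP.
  - move=> v; rewrite -mulr_suml.
    by rewrite (sum_independent (fun I => v \in I) (x \o Some)) ler_pdivlMr// mul1r.
exists (fun v => u (inl v)); split=> // [|I indI].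
  have := uE None; rewrite big_sumType /= => ->.
  rewrite [X in _ + X]big1 ?addr0 => [|J _]; last by rewrite mulr0.
  by apply: eq_bigr => v _; rewrite mulr1.
have := uE (Some I); rewrite big_sumType /= indI => eq1.
rewrite -lerN2 -[leLHS]/(- true%:R) eq1 -[leRHS]addr0 lerD//.
  rewrite -sumrN [leRHS]big_mkcond /=; apply: ler_sum => v _.
  by case: ifP; rewrite ?mulrN1// oppr0 mulr0.
by apply: sumr_le0 => J _; rewrite mulrN oppr_le0 mulr_ge0.
Qed.

(** One vertex at a time: if [x] is covered [c] times, each set is split into a share [c^-1] that
    keeps [x] and a share [1 - c^-1] that drops it. The total mass and the coverage of the other
    vertices do not change. *)
Lemma exact_cover_seq (r : seq G) : uniq r ->
  exists (O : finType) (mu : O -> R) (S : O -> {set G}),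
  [/\ forall o, 0 <= mu o, forall o, independent (S o), \sum_o mu o = a,
      forall v, 1 <= \sum_(o | v \in S o) mu o &
      forall v, v \in r -> \sum_(o | v \in S o) mu o = 1].
Proof.
elim: r => [_|x r IHr /= /andP[xr uniq_r]].
  have [f [f01 fcov] fa] := chi_f_attained R G.
  exists {I in @independent G}, (fun I => f (val I)), val.
  split=> // [o|o||v]; [|exact: valP| |].
  - by have /andP[] := f01 _ (valP o).
  - by rewrite (sum_independent predT) -fa; apply: eq_bigl => I; rewrite andbT.
  - by rewrite (sum_independent (fun I => v \in I)).
have [O [mu [S [mu0 indS mua cov covr]]]] := IHr uniq_r.
pose c := \sum_(o | x \in S o) mu o.
have c0 : 0 < c by exact: lt_le_trans ltr01 (cov x).
have ci : 0 <= c^-1 <= 1 by rewrite invr_ge0 ltW//= invf_le1// cov.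
case/andP: ci => ci0 ci1.
pose mu' (p : O * bool) := mu p.1 * (if p.2 then c^-1 else 1 - c^-1).
pose S' (p : O * bool) := if p.2 then S p.1 else (S p.1 :\ x)%SET.
have sumE (P : pred (O * bool)) : \sum_(p | P p) mu' p =
    \sum_(o | P (o, true)) mu o * c^-1 + \sum_(o | P (o, false)) mu o * (1 - c^-1).
  transitivity (\sum_o \sum_b if P (o, b) then mu' (o, b) else 0).
    by rewrite pair_bigA big_mkcond; apply: eq_bigr => -[].
  under eq_bigr do rewrite big_bool /=.
  by rewrite big_split /= -!big_mkcond.
have covx : \sum_(p | x \in S' p) mu' p = 1.
  rewrite sumE /= [X in _ + X]big_pred0; last by move=> o; rewrite !inE eqxx.
  by rewrite addr0 -mulr_suml divff ?gt_eqF.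
have covE v : v != x -> \sum_(p | v \in S' p) mu' p = \sum_(o | v \in S o) mu o.
  move=> vx; rewrite sumE /=; under [X in _ + X]eq_bigl do rewrite !inE vx.
  by rewrite -!mulr_suml -mulrDr addrCA subrr addr0 mulr1.
exists (O * bool)%type, mu', S'; split.
- by case=> o [] /=; rewrite mulr_ge0// subr_ge0.
- case=> o b; apply: independentS (indS o); rewrite /S' /=.
  by case: b => //; exact: subsetDl.
- by rewrite sumE /= -!mulr_suml mua; ring.
- by move=> v; have [->|/covE ->] := eqVneq v x; rewrite ?covx.
- move=> v; rewrite inE; have [->//|vx /=] := eqVneq v x.
  by rewrite covE//; exact: covr.
Qed.

Lemma exact_cover : exists (O : finType) (mu : O -> R) (S : O -> {set G}),
  [/\ forall o, 0 <= mu o, forall o, independent (S o), \sum_o mu o = a &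
      forall v, \sum_(o | v \in S o) mu o = 1].
Proof.
have [O [mu [S [mu0 indS mua _ muS]]]] := exact_cover_seq (enum_uniq G).
by exists O, mu, S; split=> // v; rewrite muS// mem_enum.
Qed.

End FractionalChromaticNumberTheory.

(** Here [s], [t], [u] stand for the weights of the cores, of the rests and of the unions of two
    successive cores. The bounds for [t] and [s] use the same coefficients [m j.+1], so [u] cancels
    when they are added. *)
Lemma weighted_chain_le (R : realFieldType) (q : R) (s t u : nat -> R) k :
  1 <= q -> (forall j, t j + t j.+1 + (q + 1) * u j <= q + 1) ->
  (forall j, s j <= u j) -> (forall j, s j.+1 <= u j) -> t k = 0 ->
  \sum_(j < k.+1) q ^+ j * (s j + t j) <=
    \sum_(j < k.+1) q ^+ j - 1 + (if odd k then 1 else s k).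
Proof.
move=> q1 tu su su' tk0.
(* Multiplying the j-th constraint by m j.+1 / (q + 1) gives t j the coefficient
   (m j + m j.+1) / (q + 1) = q ^+ j. *)
pose m j := q ^+ j - (-1) ^+ j.
have m_ge0 j : 0 <= m j.
  rewrite subr_ge0 -signr_odd; have := exprn_ege1 j q1.
  by case: (odd j) => ?; rewrite ?expr1 ?expr0; lra.
(* The carry [m l * t l] joins [m l.+1 * t l] from the next constraint; at [l = k] it vanishes with
   [t k]. *)
have t_le l : (q + 1) * (\sum_(j < l) q ^+ j * t j) + m l * t l <=
    (q + 1) * \sum_(j < l) m j.+1 * (1 - u j).
  elim: l => [|l IHl]; first by rewrite !big_ord0 /m !expr0; lra.
  rewrite !big_ord_recr /= !mulrDr.
  have := ler_wpM2l (m_ge0 l.+1) (tu l).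
  have -> : (q + 1) * (q ^+ l * t l) = (m l + m l.+1) * t l.
    by rewrite /m !exprS; ring.
  lra.
(* For even [l], [m l.+1] is [q ^+ l.+1 + 1] and also pays for the carried [s l]; for odd [l] it is
   [q ^+ l.+1 - 1], which leaves one [s l.+1] to carry. *)
have s_le l : \sum_(j < l.+1) q ^+ j * s j <=
    \sum_(j < l) m j.+1 * u j + (if odd l then 0 else s l).
  elim: l => [|l IHl]; first by rewrite big_ord_recr !big_ord0 /= expr0; lra.
  rewrite big_ord_recr [in leRHS]big_ord_recr /= /m -signr_odd /=.
  have ql : 1 <= q ^+ l.+1 by exact: exprn_ege1.
  have := su l; have := su' l; move: IHl; set x := q ^+ l.+1 in ql *.
  case: (odd l) => /= IHl hu hu'; rewrite ?expr1 ?expr0.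
    have := ler_wpM2l (_ : 0 <= x - 1) hu; lra.
  have := ler_wpM2l (_ : 0 <= x) hu; lra.
have m_sum l : \sum_(j < l) m j.+1 = \sum_(j < l.+1) q ^+ j - (~~ odd l)%:R.
  elim: l => [|l IHl]; first by rewrite big_ord_recr !big_ord0 /= expr0; ring.
  rewrite big_ord_recr [in RHS]big_ord_recr /= IHl /m -signr_odd /=.
  by case: (odd l); rewrite /= ?expr1 ?expr0; ring.
have q10 : 0 < q + 1 by lra.
have := t_le k; rewrite tk0 mulr0 addr0 ler_pM2l// => tk.
have -> : \sum_(j < k.+1) q ^+ j * (s j + t j) =
    \sum_(j < k.+1) q ^+ j * s j + \sum_(j < k) q ^+ j * t j.
  under eq_bigr do rewrite mulrDr.
  by rewrite big_split /= [X in _ + X]big_ord_recr /= tk0 mulr0 addr0.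
have sumE : \sum_(j < k) m j.+1 * (1 - u j) + \sum_(j < k) m j.+1 * u j =
    \sum_(j < k) m j.+1.
  by rewrite -big_split; apply: eq_bigr => j _ /=; ring.
have := s_le k; have := m_sum k; case: (odd k) => /=; rewrite ?mulr1n; lra.
Qed.

(** * Weights of chains of level sets *)

Section FractionalClique.
Variables (R : realType) (G : sgraph) (w : G -> R).
Local Notation a := (chi_f R G).
Local Notation q := (a - 1).
Hypothesis w_ge0 : forall v, 0 <= w v.
Hypothesis w_ind : forall I : {set G}, independent I -> \sum_(v in I) w v <= 1.

Lemma sum_setU_disjoint (D E : {set G}) : [disjoint D & E] ->
  \sum_(v in D :|: E) w v = \sum_(v in D) w v + \sum_(v in E) w v.
Proof. by move=> DE; rewrite -bigU//; apply: eq_bigl => v; rewrite !inE. Qed.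

Lemma le_sum_set (D E : {set G}) : D \subset E ->
  \sum_(v in D) w v <= \sum_(v in E) w v.
Proof.
move=> DE; rewrite [leRHS](big_setID D) /= (finset.setIidPr DE) lerDl.
exact: sumr_ge0.
Qed.

(** For each independent [I], the set [(D :&: I) :|: E] is independent, hence of weight at most 1;
    these bounds are averaged over an optimal colouring. *)
Lemma clique_residual (D E : {set G}) : independent E -> [disjoint D & E] ->
  {in E & D, forall x y, ~~ adj x y} ->
  \sum_(v in D) w v + a * \sum_(v in E) w v <= a.
Proof.
move=> indE DE noadj; have [f [f01 fcov] fa] := chi_f_attained R G.
have f0 I : independent I -> 0 <= f I by move=> /f01/andP[].
rewrite -lerBrDr -[X in X - _]mulr1 -mulrBr -[X in X * _]fa mulr_suml.
apply: (@le_trans _ _ (\sum_(v in D) w v *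
    \sum_(I | independent I && (v \in I)) f I)).
  by apply: ler_sum => v _; rewrite ler_peMr.
under eq_bigr do rewrite mulr_sumr.
rewrite (exchange_big_dep (@independent G)) /=; last by move=> v I _ /andP[].
apply: ler_sum => I indI; rewrite -mulr_suml mulrC ler_wpM2l ?f0//.
rewrite lerBrDr [X in X + _](eq_bigl (mem (D :&: I)%SET)) => [|v]; last first.
  by rewrite !inE indI.
rewrite -sum_setU_disjoint; last first.
  by apply: disjointWl DE; exact: finset.subsetIl.
apply: w_ind; apply/independentP => x y; rewrite !inE.
have [indI' indE'] := (independentP _ indI, independentP _ indE).
case/orP=> [/andP[xD xI]|xE] /orP[/andP[yD yI]|yE].
- exact: indI'.
- by rewrite adj_sym noadj.
- exact: noadj.
- exact: indE'.
Qed.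

Definition edge_free (P Q : {set G}) := {in P & Q, forall x y, ~~ adj x y}.

(* [P], [Q], [X], [Y] are consecutive levels of an independent set of a cone. *)
Lemma consecutive_levels (P Q X Y : {set G}) :
  edge_free P Q -> edge_free Q X -> edge_free X Y ->
  \sum_(v in Q :\: (P :|: X)) w v + \sum_(v in X :\: (Q :|: Y)) w v
    + a * \sum_(v in Q :&: (P :|: X) :|: X :&: (Q :|: Y)) w v <= a.
Proof.
move=> PQ QX XY; set E := Q :&: (P :|: X) :|: X :&: (Q :|: Y).
(* A vertex of [E] lies in [P] or [X], next to [Q], and in [Q] or [Y], next to [X]; so it has no
   neighbour in either. *)
have noadj : edge_free E (Q :|: X).
  move=> x y; rewrite !inE => xE yQX; apply/negP => xy.
  have yx : adj y x by rewrite adj_sym.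
  have nPQ xP yQ := negP (PQ x y xP yQ) xy.
  have nQX xQ yX := negP (QX x y xQ yX) xy.
  have nXQ xX yQ := negP (QX y x yQ xX) yx.
  have nYX xY yX := negP (XY y x yX xY) yx.
  case/orP: yQX => [yQ|yX]; case/orP: xE => /andP[] => [xQ|xX] /orP[]; by auto.
have EQX : E \subset Q :|: X.
  by apply: finset.setUSS; exact: finset.subsetIl.
have indE : independent E.
  by apply/independentP => x y xE /(fintype.subsetP EQX); exact: noadj.
rewrite -sum_setU_disjoint; last first.
  rewrite -setI_eq0; apply/eqP/setP => x; rewrite !inE.
  by case: (x \in Q); case: (x \in X); rewrite ?orbT ?andbF.
apply: clique_residual => //.
- rewrite -setI_eq0; apply/eqP/setP => x; rewrite !inE.
  by case: (x \in Q); case: (x \in X); rewrite ?orbT ?andbF//=;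
    case: (x \in P); case: (x \in Y).
- move=> x y xE yD; apply: noadj => //; move: yD; rewrite !inE.
  by case: (y \in Q); case: (y \in X); rewrite ?orbT ?andbF.
Qed.

(** Indices are shifted by one so that the first weighted level has a predecessor [C 0]. The final
    inclusion puts the last level entirely in its core, which gives [t k = 0]. *)
Lemma level_chain_le (C : nat -> {set G}) k : 2 <= a ->
  (forall j, edge_free (C j) (C j.+1)) -> C k.+1 \subset C k.+2 ->
  \sum_(j < k.+1) q ^+ j * \sum_(v in C j.+1) w v <=
    \sum_(j < k.+1) q ^+ j - 1 +
      (if odd k then 1 else \sum_(v in C k.+1) w v).
Proof.
move=> a2 Cfree Ck.
pose S j := (C j.+1 :&: (C j :|: C j.+2))%SET.
pose s j := \sum_(v in S j) w v; pose t j := \sum_(v in C j.+1 :\: (C j :|: C j.+2)) w v.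
pose u j := \sum_(v in S j :|: S j.+1) w v.
have stE j : \sum_(v in C j.+1) w v = s j + t j.
  exact: big_setID.
under eq_bigr do rewrite stE.
have tk : t k = 0.
  rewrite /t big1// => v; rewrite !inE => /andP[+ vC].
  by rewrite (fintype.subsetP Ck _ vC) orbT.
rewrite stE tk addr0; apply: (@weighted_chain_le _ _ s t u) => //.
- by lra.
- by move=> j; rewrite subrK; exact: consecutive_levels.
- by move=> j; apply: le_sum_set; exact: finset.subsetUl.
- by move=> j; apply: le_sum_set; exact: finset.subsetUr.
Qed.

End FractionalClique.

(** * Level chains in a single cone *)

Section ConeLevels.
Variables (R : realType) (G : sgraph) (w : G -> R).
Local Notation a := (chi_f R G).
Local Notation q := (a - 1).
Hypothesis w_ge0 : forall v, 0 <= w v.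
Hypothesis w_ind : forall I : {set G}, independent I -> \sum_(v in I) w v <= 1.
Hypothesis a2 : 2 <= a.

Variables (A : nat -> {set G}) (k : nat).
Hypothesis A0_ind : independent (A 0).
Hypothesis A_free : forall i, (i < k)%N -> edge_free (A i) (A i.+1).

(* The levels are counted down from the apex. As the base level is independent, it
   can be repeated, which puts it entirely in its core. *)
Let C j := if j is 0 then finset.set0 else A (k.+1 - j)%N.

Let C_free j : edge_free (C j) (C j.+1).
Proof.
case: j => [|j]; first by move=> x y; rewrite inE.
rewrite /C !subSS; have [kj|jk] := leqP k j.
  have -> : (k - j.+1 = 0)%N by lia.
  have -> : (k - j = 0)%N by lia.
  exact/independentP.
have -> : (k - j = (k - j.+1).+1)%N by lia.
move=> x y xA yA; rewrite adj_sym; apply: (@A_free (k - j.+1)) => //; lia.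
Qed.

Let C_end : C k.+1 \subset C k.+2.
Proof. by rewrite /C !subSS subnn (_ : k - k.+1 = 0)%N //; lia. Qed.

Lemma cone_levels_le :
  \sum_(j < k.+1) q ^+ j * \sum_(v in A (k - j)) w v <=
    \sum_(j < k.+1) q ^+ j - 1 + (if odd k then 1 else \sum_(v in A 0) w v).
Proof.
have := level_chain_le w_ge0 w_ind a2 C_free C_end.
by rewrite /C subnn; under eq_bigr do rewrite subSS.
Qed.

(** The empty top level is dropped, and the chain below it, whose last term is at most 1, is scaled
    by [q]. *)
Lemma cone_levels_apex_le : A k = finset.set0 ->
  \sum_(j < k.+1) q ^+ j * \sum_(v in A (k - j)) w v <=
    \sum_(j < k.+1) q ^+ j - 1.
Proof.
have q_ge0 : 0 <= q by rewrite subr_ge0 (le_trans _ a2)// ler1n.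
move=> Ak; rewrite !big_ord_recl /= subn0 Ak big_set0 mulr0 add0r expr0 addrAC subrr add0r.
have [->|k_gt0] := posnP k; first by rewrite !big_ord0.
have kE : k = k.-1.+1 by rewrite prednK.
have C_end' : C k.-1.+2 \subset C k.-1.+3 by rewrite -kE.
have := level_chain_le w_ge0 w_ind a2 (fun j => @C_free j.+1) C_end'.
set X := (X in _ <= X) => chain.
have {chain} : \sum_(j < k.-1.+1) q ^+ j * \sum_(v in C j.+2) w v <=
    \sum_(j < k.-1.+1) q ^+ j.
  apply: (le_trans chain); rewrite /X -addrA gerDl addrC subr_le0.
  by case: ifP => // _; rewrite /C -kE subnn; exact: w_ind.
move/(ler_wpM2l q_ge0); rewrite !mulr_sumr -kE => chain.
under eq_bigr do rewrite /bump /= add1n exprS -mulrA -[(k - _)%N]/(k.+1 - _.+1)%N.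
by under [leRHS]eq_bigr do rewrite /bump /= add1n exprS.
Qed.

End ConeLevels.

(** * Vertices of the generalized cone and the lower bound *)

Section ConeVertices.
Local Open Scope quotient_scope.
Variables (H G : sgraph) (k : nat).
Let h := fun _ : H => k.+1.
Local Notation Delta := (hcone h G).

Definition hcone_pt (v : H) (s : cone G k.+1) : Delta :=
  \pi_(hcone_vertex h G) (existT (fun v => cone G (h v)) v s).

Lemma hcone_pt_base v v' x : hcone_pt v (Some (x, ord0)) = hcone_pt v' (Some (x, ord0)).
Proof. by apply/eqmodP; rewrite /= /ident /base /= eqxx orbT. Qed.

Lemma hcone_adj_cone v s t : cone_adj s t -> adj (hcone_pt v s) (hcone_pt v t).
Proof.
move=> st; apply/existsP; exists (existT _ v s); apply/existsP.
by exists (existT _ v t); rewrite !eqxx /copies_adj tagged_asE /= eqxx st.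
Qed.

Lemma hcone_adj_apex v v' : adj v v' -> adj (hcone_pt v None) (hcone_pt v' None).
Proof.
move=> vv'; apply/existsP; exists (existT _ v None); apply/existsP.
by exists (existT _ v' None); rewrite !eqxx /copies_adj /= vv' orbT.
Qed.

Section LowerBound.
Variables (R : realType) (w : G -> R) (u : H -> R) (B : R).
Local Notation a := (chi_f R G).
Local Notation q := (a - 1).
Local Notation s := (\sum_(j < k.+1) q ^+ j).
Hypothesis a2 : 2 <= a.
Hypothesis w_ge0 : forall x, 0 <= w x.
Hypothesis w_sum : \sum_x w x = a.
Hypothesis w_ind : forall I : {set G}, independent I -> \sum_(x in I) w x <= 1.
Hypothesis u_ge0 : forall v, 0 <= u v.
Hypothesis u_sum : \sum_v u v = B.
Hypothesis u_ind : forall T : {set H}, independent T -> \sum_(v in T) u v <= 1.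
Hypothesis B_ge1 : 1 <= B.
Hypothesis kB : ~~ odd k \/ B = 1.

Section IndependentSet.
Variable S : {set Delta}.
Hypothesis indS : independent S.

Let A v i := [set x | hcone_pt v (Some (x, inord i)) \in S].
Let T := [set v | hcone_pt v None \in S].

Let A0E v v' : A v 0 = A v' 0.
Proof.
apply/setP => x; rewrite !inE.
have -> : inord 0 = ord0 :> 'I_k.+1 by apply: val_inj; rewrite /= inordK.
by rewrite (hcone_pt_base v v').
Qed.

Let T_ind : independent T.
Proof.
apply/independentP => v v'; rewrite !inE => vS v'S.
apply: contra (independentP _ indS _ _ vS v'S); exact: hcone_adj_apex.
Qed.

Let A0_ind v : independent (A v 0).
Proof.
apply/independentP => x y; rewrite !inE => xS yS.
apply: contra (independentP _ indS _ _ xS yS) => xy.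
by apply: hcone_adj_cone => /=; rewrite xy !inordK//= orbT.
Qed.

Let A_free v i : (i < k)%N -> edge_free (A v i) (A v i.+1).
Proof.
move=> ik x y; rewrite !inE => xS yS.
apply: contra (independentP _ indS _ _ xS yS) => xy.
by apply: hcone_adj_cone; rewrite /= xy !inordK ?eqxx// ltnW.
Qed.

Let A_apex v : v \in T -> A v k = finset.set0.
Proof.
rewrite inE => vS; apply/setP => x; rewrite !inE; apply/negP => xS.
have := independentP _ indS _ _ xS vS; apply/negP/negPn.
by apply: hcone_adj_cone; rewrite /= inordK.
Qed.

Let F v := \sum_(j < k.+1) q ^+ j * \sum_(x in A v (k - j)) w x.

(** The sum of the [u v * F v] counts the common base level with total factor [B * q ^+ k]; the term
    in [1 - B] corrects this. Copies whose apex is in [S] satisfy the sharper bound [FTle]. *)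
Lemma cone_weight_le v0 :
  (1 - B) * \sum_(x in A v0 0) w x + \sum_v u v * F v + \sum_(v in T) u v <=
    1 + B * (s - 1).
Proof.
set x := \sum_(x in A v0 0) w x.
have x_le1 : x <= 1 by exact: w_ind.
have x_ge0 : 0 <= x by apply: sumr_ge0.
have Fle v : F v <= s - 1 + (if odd k then 1 else x).
  rewrite /x (A0E v0 v).
  exact: (@cone_levels_le R G w w_ge0 w_ind a2 (A v) k (A0_ind v) (@A_free v)).
have FTle v : v \in T -> F v <= s - 1.
  move=> vT; exact: (@cone_levels_apex_le R G w w_ge0 w_ind a2 (A v) k
    (A0_ind v) (@A_free v) (A_apex vT)).
pose z : R := if odd k then 1 else x.
have sumF : \sum_v u v * F v <= B * (s - 1 + z) - z * \sum_(v in T) u v.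
  rewrite -u_sum mulr_suml mulr_sumr [in leRHS](bigID (mem T)) [leLHS](bigID (mem T)) /=.
  rewrite addrAC -sumrB lerD//; apply: ler_sum => v vT.
    have := ler_wpM2l (u_ge0 v) (FTle v vT); lra.
  exact: ler_wpM2l.
have y1 := u_ind T_ind.
(* With [y] the [u]-weight of [T], even [k] reduces to [x + y - x * y <= 1], that is,
   [0 <= (1 - x) * (1 - y)]. For odd [k], where [B = 1], the terms in [y] cancel. *)
case: (kB) => [/negbTE ok|B1]; move: sumF; rewrite /z ?ok.
  have := mulr_ge0 (_ : 0 <= 1 - x) (_ : 0 <= 1 - \sum_(v in T) u v); lra.
rewrite B1; case: (odd k); first lra.
have := mulr_ge0 (_ : 0 <= 1 - x) (_ : 0 <= 1 - \sum_(v in T) u v); lra.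
Qed.

End IndependentSet.

(** A packing of total weight [a * D + B] puts at most [D] on each independent set. The excess over
    [a] is [tau] for [B = 1] and [chi_f R H * tau'] for [B = chi_f R H]. *)
Lemma chi_f_hcone_ge : a + B / (1 + B * (s - 1)) <= chi_f R Delta.
Proof.
have /card_gt0P[v0 _] := vertex_gt0 H.
have q_ge1 : 1 <= q by rewrite lerBrDr.
have q_gt0 : 0 < q by exact: lt_le_trans ltr01 q_ge1.
set D := 1 + B * (s - 1).
have B_gt0 : 0 < B by exact: lt_le_trans ltr01 B_ge1.
have D_gt0 : 0 < D.
  rewrite /D big_ord_recl expr0 addrAC subrr add0r ltr_pwDl//.
  by rewrite mulr_ge0 ?(ltW B_gt0)// sumr_ge0// => j _; rewrite exprn_ge0// ltW.
(* The weight of the base level that makes the total weight equal to a * D + B. *)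
pose c0 := 1 + B * (q ^+ k - 1).
have c0_ge0 : 0 <= c0.
  by rewrite addr_ge0// mulr_ge0 ?(ltW B_gt0)// subr_ge0 exprn_ege1.
(* The summands are the base, listed once through [v0], the levels [k - j] above it, and the
   apexes. *)
pose W (o : G + H * (G * 'I_k) + H) : R := match o with
  | inl (inl x) => c0 * w x
  | inl (inr (v, (x, j))) => u v * (q ^+ j * w x)
  | inr v => u v end.
pose P (o : G + H * (G * 'I_k) + H) : Delta := match o with
  | inl (inl x) => hcone_pt v0 (Some (x, inord 0))
  | inl (inr (v, (x, j))) => hcone_pt v (Some (x, inord (k - j)))
  | inr v => hcone_pt v None end.
have sumE (S : {set Delta}) : \sum_(o | P o \in S) W o =
    c0 * (\sum_(x in [set x | hcone_pt v0 (Some (x, inord 0)) \in S]) w x)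
    + (\sum_v u v * \sum_(j < k) q ^+ j *
         \sum_(x in [set x | hcone_pt v (Some (x, inord (k - j))) \in S]) w x)
    + (\sum_(v in [set v | hcone_pt v None \in S]) u v).
  rewrite !big_sumType /=; congr (_ + _ + _).
  - by rewrite mulr_sumr; apply: eq_big => x; rewrite ?inE.
  - transitivity (\sum_v \sum_x \sum_j
        if P (inl (inr (v, (x, j)))) \in S then W (inl (inr (v, (x, j)))) else 0).
      rewrite big_mkcond; under [RHS]eq_bigr do rewrite pair_bigA.
      by rewrite pair_bigA; apply: eq_bigr => -[v [x j]].
    apply: eq_bigr => v _; rewrite exchange_big mulr_sumr /=.
    apply: eq_bigr => j _; rewrite [in RHS]big_mkcond /= !mulr_sumr.
    apply: eq_bigr => x _; rewrite inE.
    by case: ifP => _; rewrite ?mulr0.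
  - by apply: eq_big => v; rewrite ?inE.
have W_ge0 o : 0 <= W o.
  by case: o => [[x|[v [x j]]]|v] /=; rewrite ?mulr_ge0// exprn_ge0// ltW.
have total : \sum_o W o = a * D + B.
  transitivity (\sum_(o | P o \in [set: Delta]%SET) W o).
    by apply: eq_bigl => o; rewrite inE.
  have wT (A : {set G}) : A = [set: G]%SET -> \sum_(x in A) w x = a.
    by move=> ->; rewrite -w_sum; apply: eq_bigl => x; rewrite inE.
  rewrite sumE wT; last by apply/setP => x; rewrite !inE.
  have -> : \sum_(v in [set v | hcone_pt v None \in [set: Delta]%SET]) u v = B.
    by rewrite -u_sum; apply: eq_bigl => v; rewrite !inE.
  have -> : \sum_v u v * \sum_(j < k) q ^+ j * \sum_(x in [set x |
        hcone_pt v (Some (x, inord (k - j))) \in [set: Delta]%SET]) w x =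
      B * ((\sum_(j < k) q ^+ j) * a).
    rewrite -u_sum mulr_suml; apply: eq_bigr => v _; congr (_ * _).
    rewrite mulr_suml; apply: eq_bigr => j _; rewrite wT//.
    by apply/setP => x; rewrite !inE.
  by rewrite /c0 /D big_ord_recr /=; ring.
have := @chi_f_ge_packing R Delta _ (fun o => W o / D) P.
rewrite -mulr_suml total mulrDl mulfK ?gt_eqF//; apply => [o|S indS].
  by rewrite divr_ge0// ltW.
rewrite -mulr_suml ler_pdivrMr// mul1r sumE.
apply: le_trans (cone_weight_le indS v0); rewrite le_eqVlt; apply/orP; left.
apply/eqP; congr (_ + _).
set X := \sum_(x in [set x | hcone_pt v0 (Some (x, inord 0)) \in S]) w x.
have -> : \sum_v u v * \sum_(j < k.+1) q ^+ j * \sum_(x in [set x |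
      hcone_pt v (Some (x, inord (k - j))) \in S]) w x =
    \sum_v u v * (\sum_(j < k) q ^+ j * \sum_(x in [set x |
      hcone_pt v (Some (x, inord (k - j))) \in S]) w x) + B * (q ^+ k * X).
  rewrite -u_sum mulr_suml -big_split; apply: eq_bigr => v _ /=.
  rewrite big_ord_recr /= subnn mulrDr; congr (_ + _ * (_ * _)).
  apply: eq_bigl => x; rewrite !inE (_ : inord 0 = ord0).
    by rewrite (hcone_pt_base v v0).
  by apply: val_inj; rewrite /= inordK.
by rewrite /c0; ring.
Qed.

End LowerBound.

End ConeVertices.

(** * Independent sets of the generalized cone prescribed level by level *)

Section LevelSets.
Local Open Scope quotient_scope.
Variables (H G : sgraph) (k : nat).
Let h := fun _ : H => k.+1.
Local Notation Delta := (hcone h G).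

Definition level_pred (L : H -> nat -> {set G}) (T : {set H})
    (p : cone_copies h G) : bool :=
  match tagged p with
  | Some (x, i) => x \in L (tag p) i
  | None => tag p \in T
  end.

(** Membership is read off the chosen representative. Only base vertices are glued, so it is well
    behaved once [L v 0] is the same for all [v]. *)
Definition level_set L T : {set Delta} := 
  [set d : Delta | level_pred L T (repr (d : hcone_vertex h G))].

Lemma hcone_ptP (d : Delta) : exists v s, d = hcone_pt v s.
Proof.
rewrite -[d](@reprK _ (hcone_vertex h G)); case: (repr _) => v s; by exists v, s.
Qed.

Lemma level_set_pt L T v s : (forall v v', L v 0 = L v' 0) ->
  (hcone_pt v s \in level_set L T) =
  if s is Some (x, i) then x \in L v i else v \in T.
Proof.
move=> L0; rewrite inE /hcone_pt; set p := existT _ v s.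
have -> : level_pred L T (repr (\pi_(hcone_vertex h G) p)) = level_pred L T p.
  have /eqmodP : repr (\pi_(hcone_vertex h G) p) = p %[mod hcone_vertex h G].
    by rewrite reprK.
  move: (repr _) => p' /= /orP[/eqP->//|/andP[+ /eqP]].
  rewrite /level_pred /base; case: p' p => [v' s'] [v1 s1] /=.
  case: s' => [[x i]|//]; case: ifP => // /eqP i0 _.
  case: s1 => [[y j]|//]; case: ifP => // /eqP j0 [->].
  by rewrite i0 j0 (L0 v' v1).
by rewrite /level_pred /p; case: s p => [[]|].
Qed.

Lemma level_set_independent L T : (forall v v', L v 0 = L v' 0) ->
  (forall v, independent (L v 0)) ->
  (forall v i, (i < k)%N -> edge_free (L v i) (L v i.+1)) ->
  independent T -> (forall v, v \in T -> L v k = finset.set0) ->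
  independent (level_set L T).
Proof.
move=> L0 L0ind Lfree Tind Tk; apply/independentP => d e dS eS.
apply/negP => /existsP[[v s]] /existsP[[v' t]] /and3P[/eqP pd /eqP qe].
move: dS eS; rewrite -{}pd -{}qe -!/(hcone_pt _ _) !level_set_pt// => dS eS.
have no_apex x (i : 'I_k.+1) u : x \in L u i -> u \in T -> (i.+1 == k.+1)%N = false.
  move=> xL /Tk uk; apply/negP; rewrite eqSS => /eqP ik.
  by rewrite ik uk inE in xL.
rewrite /copies_adj /=; case/orP; last first.
  case/and3P=> /eqP s0 /eqP t0; apply/negP.
  by move: dS eS; rewrite s0 t0 => vT v'T; exact: (independentP _ Tind).
case/andP=> /eqP vv'; case: _ / vv' t eS => t eS; rewrite tagged_asE /=.
case: s t dS eS => [[x i]|] [[y j]|] //= xL yL.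
- case/andP=> xy /or3P[/eqP ij|/eqP ji|/andP[/eqP i0 /eqP j0]].
  + have ik : (i < k)%N by rewrite -ltnS ij ltn_ord.
    by rewrite -ij in yL; have := Lfree v i ik x y xL yL; rewrite xy.
  + have jk : (j < k)%N by rewrite -ltnS ji ltn_ord.
    by rewrite -ji in xL; have := Lfree v j jk y x yL xL; rewrite adj_sym xy.
  + rewrite i0 in xL; rewrite j0 in yL.
    by have := independentP _ (L0ind v) x y xL yL; rewrite xy.
- by rewrite (no_apex x i v).
- by rewrite (no_apex y j v).
Qed.

(** Level [j] is the empty one separating [I] from the first full level, so the base is never
    full. *)
Definition cut_levels (j : nat) (I : {set G}) (i : nat) : {set G} :=
  if (i < j)%N then I else if odd (i - j) then finset.setT else finset.set0.

Lemma cut_levels_free j I i : independent I ->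
  edge_free (cut_levels j I i) (cut_levels j I i.+1).
Proof.
move=> /independentP indI x y; rewrite /cut_levels.
have [ij|ji] := ltnP i.+1 j; first by rewrite ltnW//; exact: indI.
move: ji; rewrite leq_eqVlt => /predU1P[->|ji]; first by rewrite ltnSn subnn !inE.
have -> : (i < j)%N = false by lia.
by rewrite subSn//=; case: (odd _); rewrite /= !inE.
Qed.

Lemma cut_levels0_independent j I : independent I -> independent (cut_levels j I 0).
Proof.
by rewrite /cut_levels sub0n; case: ifP => // _ _; exact: independent0.
Qed.

End LevelSets.

(** The products [(q + 1) * q ^+ j] pair successive powers downwards from [q ^+ i.-1]; only [q ^+ 0]
    is left over, when [i] is odd. *)
Lemma odd_geometric_sum (R : comRingType) (q : R) i :
  (q + 1) * (\sum_(j < i | odd (i - j.+1)) q ^+ j) =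
  \sum_(j < i) q ^+ j - (odd i)%:R.
Proof.
elim: i => [|i IHi]; first by rewrite !big_ord0 mulr0 subr0.
rewrite big_mkcond big_ord_recr /= subnn addr0 -big_mkcond /=.
have -> : \sum_(j < i | odd (i.+1 - j.+1)) q ^+ j =
    \sum_(j < i) q ^+ j - \sum_(j < i | odd (i - j.+1)) q ^+ j.
  apply/eqP; rewrite eq_sym subr_eq eq_sym addrC; apply/eqP.
  rewrite [RHS](bigID (fun j : 'I_i => odd (i - j.+1))) /=; congr (_ + _).
  by apply: eq_bigl => j; rewrite subSS -(subnSK (ltn_ord j)).
have geo : q * (\sum_(j < i) q ^+ j) + 1 = \sum_(j < i.+1) q ^+ j.
  rewrite big_ord_recl expr0 mulr_sumr addrC; congr (_ + _).
  by apply: eq_bigr => j _; rewrite exprS.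
rewrite mulrBr IHi -geo; case: (odd i) => /=; ring.
Qed.

(** * The upper bound by an explicit cover *)

Section UpperBound.
Variables (R : realType) (H G : sgraph) (k : nat) (theta : R).
Local Notation Delta := (hcone (fun _ : H => k.+1) G).
Local Notation a := (chi_f R G).
Local Notation b := (chi_f R H).
Local Notation q := (a - 1).
Hypothesis a2 : 2 <= a.
Hypothesis ba : b <= a.
Hypothesis theta_ge0 : 0 <= theta.
Hypothesis theta_le : theta * (\sum_(j < k) q ^+ j) <= 1.
(** Exact coverage of an apex: the first term is [a * sigma], by [sigmaE]; the second comes from the
    sets with empty base, which reach apexes only for even [k]. *)
Hypothesis theta_apex : theta * (\sum_(j < k.+1) q ^+ j - (~~ odd k)%:R)
  + (~~ odd k)%:R * (theta / b) = 1.

Let b_gt0 : 0 < b. Proof. exact: lt_le_trans ltr01 (chi_f_ge1 _ _). Qed.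
Let q_ge0 : 0 <= q. Proof. by rewrite subr_ge0 (le_trans _ a2)// ler1n. Qed.

(* [r j] is the rate of the sets that are cut at level [j.+1]; those with [star j]
   leave the last level empty, so that they may contain apexes, and [sigma] is the
   proportion of them. *)
Let r j := if (j < k)%N then theta * q ^+ j else 1 - theta * \sum_(i < k) q ^+ i.
Let star j := (j < k)%N && ~~ odd (k - j.+1).
Let rS j := if star j then r j else 0.
Let rN j := if star j then 0 else r j.
Let sigma := \sum_(j < k.+1) rS j.

Let r_ge0 j : 0 <= r j.
Proof.
rewrite /r; case: ifP => _; last by rewrite subr_ge0.
by rewrite mulr_ge0// exprn_ge0.
Qed.

Let rS_ge0 j : 0 <= rS j. Proof. by rewrite /rS; case: ifP. Qed.
Let rN_ge0 j : 0 <= rN j. Proof. by rewrite /rN; case: ifP. Qed.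

Let rE j : r j = rS j + rN j.
Proof. by rewrite /rS /rN; case: ifP; rewrite ?addr0 ?add0r. Qed.

Let r_sum : \sum_(j < k.+1) r j = 1.
Proof.
rewrite big_ord_recr /= /r ltnn; under eq_bigr do rewrite ltn_ord.
by rewrite -mulr_sumr addrC subrK.
Qed.

Let rN_sum : \sum_(j < k.+1) rN j = 1 - sigma.
Proof. by rewrite -r_sum -sumrB; apply: eq_bigr => j _; rewrite rE addrC addKr. Qed.

Let sigmaE : a * sigma = theta * (\sum_(j < k.+1) q ^+ j - (~~ odd k)%:R).
Proof.
rewrite -[~~ odd k]/(odd k.+1) -odd_geometric_sum subrK mulrCA; congr (_ * _).
rewrite /sigma mulr_sumr [RHS]big_mkcond; apply: eq_bigr => j _.
rewrite /rS /star /r subSS; have := ltn_ord j; rewrite ltnS leq_eqVlt.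
case/predU1P=> [->|jk]; first by rewrite ltnn subnn.
by rewrite jk -(subnSK jk) /=.
Qed.

Let sigma_ge0 : 0 <= sigma. Proof. exact: sumr_ge0. Qed.

Let sigma_le : a * sigma <= 1.
Proof.
rewrite sigmaE -[leRHS]theta_apex lerDl; case: (odd k) => /=; first by rewrite mul0r.
by rewrite mul1r divr_ge0// ltW.
Qed.

Let sigma_lt1 : sigma < 1.
Proof.
rewrite ltNge; apply/negP => s1; have := sigma_le; rewrite leNgt => /negP; apply.
have a1 : 1 < a by rewrite (lt_le_trans _ a2)// ltr1n.
by rewrite (lt_le_trans a1)// ler_peMr// (le_trans ler01)// ltW.
Qed.

Let bsigma_le : b * sigma <= 1.
Proof. by apply: le_trans sigma_le; rewrite ler_wpM2r. Qed.

(** Exact coverage of level [i]: the sets with empty base give [theta] on odd levels, and a cut at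
    [j.+1] gives 1 below the cut and [a] on full levels. The deviation from [r_sum] is evaluated by
    [odd_geometric_sum]. *)
Let level_cover i : (i <= k)%N ->
  theta * (odd i)%:R + \sum_(j < k.+1) r j *
    (if (i <= j)%N then 1 else if odd (i - j.+1) then a else 0) = 1.
Proof.
move=> ik.
have rD j : r j * (if (i <= j)%N then 1 else if odd (i - j.+1) then a else 0) =
    r j - (if (j < i)%N then theta *
      (q ^+ j - (q + 1) * (if odd (i - j.+1) then q ^+ j else 0)) else 0).
  rewrite ltnNge; case: leqP => ij /=; first by rewrite mulr1 subr0.
  by rewrite /r (leq_trans ij ik); case: odd; ring.
under eq_bigr do rewrite rD.
rewrite sumrB r_sum -big_mkcond /=.
rewrite -(big_ord_widen k.+1 (fun j => theta * (q ^+ j - (q + 1) *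
  (if odd (i - j.+1) then q ^+ j else 0)))); last exact: leqW.
rewrite -mulr_sumr sumrB -mulr_sumr -big_mkcond odd_geometric_sum; ring.
Qed.

(** Only copies in an independent set [SH K] may use their apexes together; the others are cut
    according to [rN']. Nevertheless each single copy sees the rates [r]. The third family has mass
    [(1 - b * sigma) * a], nonnegative because [b <= a]. *)
Lemma chi_f_hcone_le : chi_f R Delta <= a + theta.
Proof.
have [OG [f [SG [f0 SGi fsum fcov]]]] := exact_cover R G.
have [OH [g [SH [g0 SHi gsum gcov]]]] := exact_cover R H.
have s1 : 1 - sigma != 0 by rewrite subr_eq0 gt_eqF.
have s_ge0 : 0 <= (1 - sigma)^-1 by rewrite invr_ge0 subr_ge0 ltW.
pose rN' j := rN j / (1 - sigma).
have rN'_sum : \sum_(j < k.+1) rN' j = 1 by rewrite -mulr_suml rN_sum divff.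
have rN'_ge0 j : 0 <= rN' j by rewrite mulr_ge0.
pose W (o : OH + OH * ('I_k.+1 * 'I_k.+1 * OG) + 'I_k.+1 * OG) : R := match o with
  | inl (inl K) => theta / b * g K
  | inl (inr (K, ((j, j'), Z))) => g K * (rS j * (rN' j' * f Z))
  | inr (j', Z) => (1 - b * sigma) * (rN' j' * f Z) end.
(* Cutting at [j.+1] or [j'.+1] keeps the base equal to [SG Z] in every copy, as the gluing
   demands. *)
pose S (o : OH + OH * ('I_k.+1 * 'I_k.+1 * OG) + 'I_k.+1 * OG) : {set Delta} := match o with
  | inl (inl K) => level_set k (fun _ => cut_levels 0 finset.set0)
      (if odd k then finset.set0 else SH K)
  | inl (inr (K, ((j, j'), Z))) =>
      level_set k (fun v => cut_levels (if v \in SH K then j else j').+1 (SG Z))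
       (if star j then SH K else finset.set0)
  | inr (j', Z) => level_set k (fun _ => cut_levels j'.+1 (SG Z)) finset.set0 end.
have W_ge0 o : 0 <= W o.
  have bs : 0 <= 1 - b * sigma by rewrite subr_ge0.
  have tb : 0 <= theta / b by rewrite divr_ge0// ltW.
  by case: o => [[K|[K [[j j'] Z]]]|[j' Z]] /=; do ?[apply: mulr_ge0 => //].
have S_ind o : independent (S o).
  case: o => [[K|[K [[j j'] I]]]|[j' I]] /=; apply: level_set_independent => //.
  - by move=> v; apply: cut_levels0_independent; exact: independent0.
  - by move=> v i _; apply: cut_levels_free; exact: independent0.
  - by case: ifP => // _; exact: independent0.
  - by move=> v; case: ifP => ok; rewrite ?inE// /cut_levels subn0 ok.
  - by move=> v; apply: cut_levels0_independent.
  - by move=> v i _; apply: cut_levels_free.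
  - by case: ifP => // _; exact: independent0.
  - move=> v; case: ifP => [/andP[jk ok] vK|_]; last by rewrite inE.
    by rewrite vK /cut_levels ltnS leqNgt jk /= (negbTE ok).
  - by move=> v; apply: cut_levels0_independent.
  - by move=> v i _; apply: cut_levels_free.
  - exact: independent0.
  - by move=> v; rewrite inE.
have sumE (P : pred (OH + OH * ('I_k.+1 * 'I_k.+1 * OG) + 'I_k.+1 * OG)) :
    \sum_(o | P o) W o = theta / b * (\sum_(K | P (inl (inl K))) g K)
    + (\sum_K g K * (\sum_(j < k.+1) rS j * (\sum_(j' < k.+1) rN' j' *
        (\sum_(Z | P (inl (inr (K, ((j, j'), Z))))) f Z))))
    + (1 - b * sigma) * (\sum_(j' < k.+1) rN' j' * (\sum_(Z | P (inr (j', Z))) f Z)).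
  rewrite !big_sumType /=; congr (_ + _ + _).
  - by rewrite mulr_sumr.
  - transitivity (\sum_K \sum_(j < k.+1) \sum_(j' < k.+1) \sum_Z
        if P (inl (inr (K, ((j, j'), Z)))) then g K * (rS j * (rN' j' * f Z)) else 0).
      rewrite big_mkcond; under [RHS]eq_bigr do rewrite pair_bigA pair_bigA.
      by rewrite pair_bigA; apply: eq_bigr => -[K [[j j'] Z]].
    apply: eq_bigr => K _; rewrite mulr_sumr; apply: eq_bigr => j _.
    rewrite !mulr_sumr; apply: eq_bigr => j' _.
    rewrite [in RHS]big_mkcond /= !mulr_sumr; apply: eq_bigr => Z _.
    by case: ifP; rewrite ?mulr0.
  - move: (1 - b * sigma) => c; transitivity (\sum_(j' < k.+1) \sum_Z
        if P (inr (j', Z)) then c * (rN' j' * f Z) else 0).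
      by rewrite big_mkcond pair_bigA; apply: eq_bigr => -[j' Z].
    rewrite mulr_sumr; apply: eq_bigr => j' _.
    rewrite [in RHS]big_mkcond /= !mulr_sumr; apply: eq_bigr => Z _.
    by case: ifP; rewrite ?mulr0.
have rN'_const (c : R) : \sum_(j' < k.+1) rN' j' * c = c.
  by rewrite -mulr_suml rN'_sum mul1r.
have rS_const (c : R) : \sum_(j < k.+1) rS j * c = sigma * c by rewrite -mulr_suml.
have W_sum : \sum_o W o = a + theta.
  rewrite (sumE predT) /= gsum fsum rN'_const rS_const -mulr_suml gsum.
  by rewrite divfK ?gt_eqF//; ring.
(* By exactness, the sets [SH K] containing [v] have mass 1 and the remaining ones [b - 1]. *)
have g_if v (x y : R) : \sum_K g K * (if v \in SH K then x else y) = x + (b - 1) * y.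
  have -> : (b - 1) * y = \sum_(K | v \notin SH K) g K * y.
    rewrite -mulr_suml; congr (_ * _); apply/eqP; rewrite subr_eq addrC -gsum -(gcov v).
    by apply/eqP; rewrite [LHS](bigID (fun K => v \in SH K)).
  rewrite (bigID (fun K => v \in SH K)) /=; congr (_ + _).
    rewrite -[RHS]mul1r -(gcov v) mulr_suml.
    by apply: eq_bigr => K ->.
  by apply: eq_bigr => K /negbTE ->.
rewrite -W_sum; apply: chi_f_le_cover W_ge0 S_ind _ => d.
have [v [s ->]] := hcone_ptP d.
rewrite sumE; case: s => [[x i]|]; last first.
  rewrite /S; under eq_bigl do rewrite level_set_pt//.
  have -> : \sum_K g K * (\sum_(j < k.+1) rS j * (\sum_(j' < k.+1) rN' j' *
      (\sum_(Z | hcone_pt v None \in S (inl (inr (K, ((j, j'), Z))))) f Z))) =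
      \sum_K g K * (if v \in SH K then sigma * a else 0).
    apply: eq_bigr => K _; congr (_ * _).
    transitivity (\sum_(j < k.+1) rS j * (if v \in SH K then a else 0)); last first.
      by rewrite rS_const; case: ifP; rewrite ?mulr0.
    apply: eq_bigr => j _; have [js|js] := boolP (star j); last first.
      by rewrite /rS (negbTE js) !mul0r.
    congr (_ * _); rewrite -[RHS]rN'_const; apply: eq_bigr => j' _; congr (_ * _).
    under eq_bigl do rewrite /= level_set_pt// js.
    by case: ifP => _; rewrite ?fsum// big_pred0.
  rewrite g_if mulr0 addr0.
  have -> : \sum_(j' < k.+1) rN' j' *
      (\sum_(Z | hcone_pt v None \in S (inr (j', Z))) f Z) = 0.
    apply: big1 => j' _; rewrite big_pred0 ?mulr0// => Z.
    by rewrite /= level_set_pt// inE.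
  rewrite mulr0 addr0 [sigma * a]mulrC sigmaE -[leLHS]theta_apex addrC lerD2r.
  case: (odd k) => /=; first by rewrite mul0r big_pred0 ?mulr0// => K; rewrite inE.
  by rewrite gcov mulr1 mul1r.
pose c j := (if (i <= j)%N then 1 else if odd (i - j.+1) then a else 0) : R.
have cE j : \sum_(Z | x \in cut_levels j.+1 (SG Z) i) f Z = c j.
  rewrite /cut_levels ltnS /c; case: (i <= j)%N; first exact: fcov.
  case: (odd _); last by apply: big_pred0 => Z; rewrite inE.
  by rewrite -[RHS]fsum; apply: eq_bigl => Z; rewrite inE.
rewrite -[leLHS](level_cover (ltn_ord i)) -addrA lerD//.
  under eq_bigl do rewrite /= level_set_pt// /cut_levels subn0 /=.
  case: (odd i); rewrite ?mulr0 ?mulr1; last first.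
    by rewrite big_pred0 ?mulr0// => K; rewrite inE.
  under eq_bigl do rewrite inE.
  by rewrite gsum divfK ?gt_eqF.
have -> : \sum_K g K * (\sum_(j < k.+1) rS j * (\sum_(j' < k.+1) rN' j' *
    (\sum_(Z | hcone_pt v (Some (x, i)) \in S (inl (inr (K, ((j, j'), Z))))) f Z))) =
    \sum_K g K * (if v \in SH K then \sum_(j < k.+1) rS j * c j
                  else sigma * \sum_(j < k.+1) rN' j * c j).
  apply: eq_bigr => K _; congr (_ * _).
  transitivity (\sum_(j < k.+1) rS j *
     (if v \in SH K then c j else \sum_(j < k.+1) rN' j * c j)); last first.
    by case: ifP; rewrite ?rS_const.
  apply: eq_bigr => j _; congr (_ * _).
  transitivity (\sum_(j' < k.+1) rN' j' * (if v \in SH K then c j else c j')).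
    apply: eq_bigr => j' _; congr (_ * _).
    under eq_bigl do rewrite /= level_set_pt//.
    by rewrite cE; case: ifP.
  by case: ifP; rewrite ?rN'_const.
rewrite g_if.
have -> : \sum_(j' < k.+1) rN' j' *
      (\sum_(Z | hcone_pt v (Some (x, i)) \in S (inr (j', Z))) f Z) =
    \sum_(j < k.+1) rN' j * c j.
  apply: eq_bigr => j _; congr (_ * _).
  by under eq_bigl do rewrite /= level_set_pt//; rewrite cE.
under eq_bigr do rewrite rE mulrDl.
rewrite big_split /= -addrA lerD2l.
(* The factors of the [rN'] sum add up: [(b - 1) * sigma + (1 - b * sigma) = 1 - sigma]. *)
have -> : \sum_(j < k.+1) rN j * c j = (1 - sigma) * \sum_(j < k.+1) rN' j * c j.
  by rewrite mulr_sumr; apply: eq_bigr => j _; rewrite /rN'; field.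
rewrite le_eqVlt; apply/orP; left; apply/eqP; ring.
Qed.

End UpperBound.

(** The apexes form one colour class and all other vertices the second; an edge from the top level
    [ord_max] to an apex gives the lower bound. *)
Lemma chi_f_hcone_edgeless (R : realType) (H G : sgraph) k :
  (forall x y : G, ~~ adj x y) -> (forall v v' : H, ~~ adj v v') ->
  chi_f R (hcone (fun _ : H => k.+1) G) = 2.
Proof.
move=> noG noH; have /card_gt0P[x _] := vertex_gt0 G.
have /card_gt0P[v _] := vertex_gt0 H.
apply/eqP; rewrite eq_le; apply/andP; split; last first.
  apply: (@chi_f_edge_ge2 _ _ (hcone_pt v (Some (x, ord_max))) (hcone_pt v None)).
  by apply: hcone_adj_cone => /=.
pose S (c : bool) : {set hcone (fun _ : H => k.+1) G} :=
  if c then level_set k (fun _ _ => finset.set0) finset.setT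
  else level_set k (fun _ _ => finset.setT) finset.set0.
have := @chi_f_le_cover R (hcone (fun _ : H => k.+1) G) bool (fun=> 1) S.
rewrite big_bool; apply=> // [[]|d].
- apply: level_set_independent => // [u|u i _ y z|]; rewrite ?inE ?independent0//.
  by apply/independentP => y z _ _; exact: noH.
- apply: level_set_independent => // [u|u i _ y z _ _||u]; rewrite ?inE ?independent0//.
  by apply/independentP => y z _ _; exact: noG.
- rewrite big_mkcond big_bool /S; have [u [s ->]] := hcone_ptP d.
  by rewrite !level_set_pt//; case: s => [[y i]|]; rewrite !inE /= ?addr0 ?add0r.
Qed.

Theorem theorem2 (R : realType) (G H : sgraph) (n : nat)
    (n_gt0 : (0 < n)%N) (le_HG : chi_f R H <= chi_f R G) :
  chi_f R (hcone (fun _ : H => n) G) =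
    if odd n then chi_f R G + chi_f R H * tau' R G H n
    else chi_f R G + tau R G n.
Proof.
case: n n_gt0 => // k _; rewrite /tau /tau' big_mkord.
have b1 := chi_f_ge1 R H.
have [a2|a2] := leP 2 (chi_f R G); last first.
  have a1 : chi_f R G = 1 by apply: chi_f_edgeless; exact: (chi_f_lt2 a2).
  have b_eq1 : chi_f R H = 1 by apply/eqP; rewrite eq_le b1 -[leRHS]a1 le_HG.
  have b2 : chi_f R H < 2 by rewrite b_eq1 ltr1n.
  rewrite (chi_f_hcone_edgeless R k (chi_f_lt2 a2) (chi_f_lt2 b2)) a1 b_eq1 subrr.
  (* The convention [0 ^+ 0 = 1] enters here. *)
  have -> : \sum_(j < k.+1) 0 ^+ j = 1 :> R.
    by rewrite big_ord_recl expr0 big1 ?addr0// => j _; rewrite exprS mul0r.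
  by rewrite !mul1r addrK invr1; case: ifP => _; ring.
have [w [w_ge0 w_sum w_ind]] := fractional_clique R G.
have q_ge1 : 1 <= chi_f R G - 1 by rewrite lerBrDr.
have s_ge1 : 1 <= \sum_(j < k.+1) (chi_f R G - 1) ^+ j.
  rewrite big_ord_recl expr0 lerDl sumr_ge0// => j _.
  by rewrite exprn_ge0// (le_trans ler01).
have sE : \sum_(j < k.+1) (chi_f R G - 1) ^+ j =
    \sum_(j < k) (chi_f R G - 1) ^+ j + (chi_f R G - 1) ^+ k.
  by rewrite big_ord_recr.
have qk : 1 <= (chi_f R G - 1) ^+ k by exact: exprn_ege1.
have geo_ge0 : 0 <= \sum_(j < k) (chi_f R G - 1) ^+ j.
  by apply: sumr_ge0 => j _; rewrite exprn_ge0// (le_trans ler01).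
set s := \sum_(j < k.+1) _ in s_ge1 sE *.
(* As [n = k.+1], odd [k] is the case of even [n]; there [theta = s^-1]. *)
rewrite /=; have [ok|ok] := boolP (odd k) => /=.
  have /card_gt0P[v0 _] := vertex_gt0 H.
  apply/eqP; rewrite eq_le; apply/andP; split.
    have s_gt0 : 0 < s by exact: lt_le_trans ltr01 s_ge1.
    apply: chi_f_hcone_le => //; first by rewrite invr_ge0 ltW.
      by rewrite ler_pdivrMl// mulr1 sE lerDl (le_trans ler01).
    by rewrite ok /= subr0 mul0r addr0 mulVf ?gt_eqF.
  (* A point mass at [v0] is a fractional clique of [H] of weight [B = 1]. *)
  have := @chi_f_hcone_ge H G k R w (fun v => (v == v0)%:R) 1 a2 w_ge0 w_sum w_ind.
  rewrite -/s !mul1r (addrCA 1 s) subrr addr0; apply=> //; last by right.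
  - by rewrite (bigD1 v0)//= eqxx big1 ?addr0// => v /negbTE ->.
  - move=> I _; rewrite big_mkcond (bigD1 v0)//= eqxx big1 ?addr0; first by case: ifP.
    by move=> v /negbTE ->; rewrite if_same.
have b_gt0 : 0 < chi_f R H by exact: lt_le_trans ltr01 b1.
have DE : chi_f R H * s + 1 - chi_f R H = 1 + chi_f R H * (s - 1) by ring.
have D_gt0 : 0 < 1 + chi_f R H * (s - 1).
  by rewrite ltr_pwDl// mulr_ge0 ?(ltW b_gt0)// subr_ge0.
rewrite DE; apply/eqP; rewrite eq_le; apply/andP; split.
  (* For even [k], with [b] standing for [chi_f R H], [theta_apex] reads
     [theta * (s - 1 + b^-1) = 1], solved by [theta = b / (1 + b * (s - 1))]. *)
  apply: chi_f_hcone_le => //.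
  - by rewrite divr_ge0// ltW.
  - rewrite mulrAC ler_pdivrMr// mul1r sE.
    have := ler_wpM2l (ltW b_gt0) qk; lra.
  - by rewrite ok /= -/s; field; rewrite !gt_eqF.
have [u [u_ge0 u_sum u_ind]] := fractional_clique R H.
by apply: (chi_f_hcone_ge a2 w_ge0 w_sum w_ind u_ge0 u_sum u_ind) => //; left.
Qed.
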